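(* Let $\widehat{a}_1,\widehat{b}_1$ be dual numbers and $\widehat{x}=x_1+\varepsilon x_2$ a dual variable, with $x_1>0$ in the second and third formulas below. Assume in each formula that the real part of every lower parameter of ${}_1F_1$ appearing in it is not in $\{0,-1,-2,\dots\}$ and that every denominator has nonzero real part. Then $$\int{}_1F_1(\widehat{a}_1;\widehat{b}_1;\widehat{x})\,d\widehat{x}=\frac{\widehat{b}_1-1}{\widehat{a}_1-1}\,{}_1F_1(\widehat{a}_1-1;\widehat{b}_1-1;\widehat{x})+C;$$ $$\int(\widehat{x})^{\widehat{b}_1-1}\,{}_1F_1(\widehat{a}_1;\widehat{b}_1;\widehat{x})\,d\widehat{x}=\frac{(\widehat{x})^{\widehat{b}_1}}{\widehat{b}_1}\,{}_1F_1(\widehat{a}_1;\widehat{b}_1+1;\widehat{x})+C;$$ $$\int(\widehat{x})^{\widehat{a}_1-2}\,{}_1F_1(\widehat{a}_1;\widehat{b}_1;\widehat{x})\,d\widehat{x}=\frac{(\widehat{x})^{\widehat{a}_1-1}}{\widehat{a}_1-1}\,{}_1F_1(\widehat{a}_1-1;\widehat{b}_1;\widehat{x})+C;$$ $$\int e^{-\widehat{x}}\,{}_1F_1(\widehat{a}_1;\widehat{b}_1;\widehat{x})\,d\widehat{x}=\frac{e^{-\widehat{x}}\,(\widehat{b}_1-1)}{1+\widehat{a}_1-\widehat{b}_1}\,{}_1F_1(\widehat{a}_1;\widehat{b}_1-1;\widehat{x})+C,$$ where $C$ is an integration constant.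
   Context: Dual numbers are $\widehat{x}=x_1+\varepsilon x_2$, $x_1,x_2\in\mathbb{R}$, $\varepsilon^2=0$, forming the commutative ring $\mathbb{R}[\varepsilon]/(\varepsilon^2)$; $x_1$ is the real part, and division by $\widehat{x}$ is possible iff $x_1\ne0$. For $x_1>0$ and $\widehat{c}=c_1+\varepsilon c_2$, $(\widehat{x})^{\widehat{c}}=x_1^{c_1}\bigl(1+\varepsilon(\frac{x_2c_1}{x_1}+c_2\log x_1)\bigr)$; also $e^{\widehat{x}}=e^{x_1}(1+\varepsilon x_2)$. The dual shifted factorial is $(\widehat{a})_0=1$, $(\widehat{a})_k=\widehat{a}(\widehat{a}+1)\cdots(\widehat{a}+k-1)$ for $k\ge1$, and the dual confluent hypergeometric function is ${}_1F_1(\widehat{a}_1;\widehat{b}_1;\widehat{x})=\sum_{k=0}^\infty\frac{(\widehat{a}_1)_k(\widehat{x})^k}{(\widehat{b}_1)_k\,k!}$, with convergence in real and dual parts. The dual derivative $\frac{d}{d\widehat{x}}$ is $\frac{\partial}{\partial x_1}$ applied to real and dual parts of a function of $\widehat{x}=x_1+\varepsilon x_2$, and the dual integral is the corresponding antiderivative: $\int F(\widehat{x})\,d\widehat{x}=G(\widehat{x})+C$ means $\frac{d}{d\widehat{x}}G(\widehat{x})=F(\widehat{x})$ (equivalently, one integrates with respect to $x_1$). *)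

(* Defs.v *)
From Stdlib Require Export Reals Factorial.
From Coquelicot Require Export Coquelicot.
From Stdlib Require Import Lra.

Declare Scope dual_scope.
Delimit Scope dual_scope with dual.

(* Dual r e is r + eps e, with eps^2 = 0. *)
Record dual : Set := Dual { re : R; du : R }.
Bind Scope dual_scope with dual.

Open Scope R_scope.

Definition dual_of_R (r : R) : dual := Dual r 0.
Definition dual_add (x y : dual) : dual := Dual (re x + re y) (du x + du y).
Definition dual_opp (x : dual) : dual := Dual (- re x) (- du x).
Definition dual_sub (x y : dual) : dual := dual_add x (dual_opp y).
Definition dual_mul (x y : dual) : dual :=
  Dual (re x * re y) (re x * du y + du x * re y).

(* The inverse is meaningful only when re x <> 0; see dual_mul_inv_r. *)
Definition dual_inv (x : dual) : dual := Dual (/ re x) (- (du x / (re x) ^ 2)).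
Definition dual_div (x y : dual) : dual := dual_mul x (dual_inv y).

Notation "0" := (dual_of_R 0) : dual_scope.
Notation "1" := (dual_of_R 1) : dual_scope.
Notation "2" := (dual_of_R 2) : dual_scope.
Infix "+" := dual_add : dual_scope.
Infix "-" := dual_sub : dual_scope.
Infix "*" := dual_mul : dual_scope.
Infix "/" := dual_div : dual_scope.
Notation "- x" := (dual_opp x) : dual_scope.

Lemma dual_ext (x y : dual) : re x = re y -> du x = du y -> x = y.
Proof. destruct x, y; simpl; intros; subst; reflexivity. Qed.

Lemma dual_ring_theory :
  ring_theory (dual_of_R 0) (dual_of_R 1)
    dual_add dual_mul dual_sub dual_opp (@eq dual).
Proof. constructor; intros; apply dual_ext; simpl; ring. Qed.

Add Ring dual_ring : dual_ring_theory.

Lemma dual_mul_inv_r (x : dual) : re x <> 0 -> (x * dual_inv x = 1)%dual.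
Proof. intros Hx; apply dual_ext; simpl; field; exact Hx. Qed.

Fixpoint dual_pow (x : dual) (k : nat) : dual :=
  match k with
  | O => 1%dual
  | S k' => (dual_pow x k' * x)%dual
  end.

(* Power with a dual exponent; meaningful only for re x > 0. *)
Definition dual_power (x c : dual) : dual :=
  Dual (Rpower (re x) (re c))
       (Rpower (re x) (re c) * (du x * re c / re x + du c * ln (re x))).

Definition dual_exp (x : dual) : dual := Dual (exp (re x)) (exp (re x) * du x).

Fixpoint dual_poch (a : dual) (k : nat) : dual :=
  match k with
  | O => 1%dual
  | S k' => (dual_poch a k' * (a + dual_of_R (INR k')))%dual
  end.

Definition hyp1F1_term (a b x : dual) (k : nat) : dual :=
  ((dual_poch a k * dual_pow x k)
     / (dual_poch b k * dual_of_R (INR (fact k))))%dual.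

(* [Series] is total.  When [lower_parameter b] holds, the real and dual parts
   both converge for every x by the ratio test, so the value is the sum. *)
Definition hyp1F1 (a b x : dual) : dual :=
  Dual (Series (fun k => re (hyp1F1_term a b x k)))
       (Series (fun k => du (hyp1F1_term a b x k))).

Definition lower_parameter (b : dual) : Prop := forall n : nat, re b <> - INR n.

(* The dual derivative at x1 + eps x2 differentiates both parts with respect to
   x1, with x2 held fixed. *)
Definition is_dual_derive (G : dual -> dual) (x l : dual) : Prop :=
  is_derive (fun t => re (G (Dual t (du x)))) (re x) (re l) /\
  is_derive (fun t => du (G (Dual t (du x)))) (re x) (du l).

(* The indefinite integral of F is G + C for the dual numbers x = x1 + eps x2
   with x1 in the (open) set D and x2 arbitrary. *)
Definition is_dual_integral (D : R -> Prop) (F G : dual -> dual) : Prop :=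
  forall x : dual, D (re x) -> is_dual_derive G x (F x).

Definition all_reals (r : R) : Prop := True.
Definition positive_reals (r : R) : Prop := 0 < r.

(* Main.v *)
Require Import Defs.
From Stdlib Require Import Reals Lra Lia.
From Coquelicot Require Import Coquelicot.

(** A function of a dual variable given by a dual power series whose real and
    dual coefficient sequences both have infinite radius of convergence may be
    differentiated term by term: writing [x = x1 + eps x2], its real part is the
    real power series [f] of the real coefficients, its dual part is
    [g x1 + x2 * f' x1] with [g] the series of the dual coefficients, and
    differentiating both in [x1] gives the same expression for the
    differentiated coefficients ([is_dual_derive_pseries]).

    The confluent series is of this kind.  The ratio of consecutive
    coefficients is [(a + k) / (b + k)] over [k + 1], and the quotient
    [(a + k) / (b + k)] is bounded in [k] for the submultiplicative norm
    [|re| + |du|], so the coefficients are dominated by [M ^ k / k!]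
    ([entire_hyp1F1_coef]).

    Each of the four integral formulas then amounts to a first-order relation
    between contiguous confluent functions and the derivative of one of them,
    - [(b - 1) F'(a-1; b-1) = (a - 1) F(a; b)],
    - [b F(a; b+1) + x F'(a; b+1) = b F(a; b)],
    - [(a - 1) F(a-1; b) + x F'(a-1; b) = (a - 1) F(a; b)],
    - [(b - 1) (F'(a; b-1) - F(a; b-1)) = (1 + a - b) F(a; b)],

    which holds coefficient by coefficient, followed by the product rule with
    the factor [x ^ c] or [exp (- x)]. *)

Open Scope dual_scope.

(** * Algebra of dual numbers *)

Lemma dual_inv_mul (x y : dual) :
  re x <> 0%R -> re y <> 0%R ->
  dual_inv (x * y) = dual_inv x * dual_inv y.
Proof. intros Hx Hy; apply dual_ext; simpl; field; auto. Qed.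

Lemma dual_mul_cancel_l (z x y : dual) : re z <> 0%R -> z * x = z * y -> x = y.
Proof.
  intros Hz E.
  replace x with (z * dual_inv z * x)
    by (rewrite dual_mul_inv_r by exact Hz; ring).
  replace y with (z * dual_inv z * y)
    by (rewrite dual_mul_inv_r by exact Hz; ring).
  replace (z * dual_inv z * x) with (dual_inv z * (z * x)) by ring.
  rewrite E; ring.
Qed.

Lemma dual_of_R_S (k : nat) : dual_of_R (INR (S k)) = dual_of_R (INR k) + 1.
Proof. rewrite S_INR; apply dual_ext; simpl; ring. Qed.

(** The norm [|x1| + |x2|] is submultiplicative, unlike [max |x1| |x2|], so it
    bounds products of ratios of coefficients. *)
Definition dual_norm (x : dual) : R := (Rabs (re x) + Rabs (du x))%R.

Lemma dual_norm_ge_0 (x : dual) : (0 <= dual_norm x)%R.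
Proof.
  unfold dual_norm.
  pose proof (Rabs_pos (re x)); pose proof (Rabs_pos (du x)); lra.
Qed.

Lemma dual_norm_mul (x y : dual) :
  (dual_norm (x * y) <= dual_norm x * dual_norm y)%R.
Proof.
  unfold dual_norm; simpl.
  pose proof (Rabs_triang (re x * du y) (du x * re y)) as T.
  rewrite !Rabs_mult in *.
  pose proof (Rabs_pos (du x)); pose proof (Rabs_pos (du y)); nra.
Qed.

Lemma dual_norm_add (x y : dual) :
  (dual_norm (x + y) <= dual_norm x + dual_norm y)%R.
Proof.
  unfold dual_norm; simpl.
  pose proof (Rabs_triang (re x) (re y)).
  pose proof (Rabs_triang (du x) (du y)); lra.
Qed.

Lemma dual_pow_parts (x : dual) (k : nat) :
  dual_pow x k
  = Dual (re x ^ k) (INR k * re x ^ pred k * du x)%R.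
Proof.
  induction k as [|k IH].
  - apply dual_ext; simpl; ring.
  - cbn [dual_pow]; rewrite IH; apply dual_ext; cbn [re du dual_mul pred].
    + simpl; ring.
    + rewrite S_INR; destruct k; simpl; ring.
Qed.

(** * Dual series *)

Definition is_dual_series (u : nat -> dual) (s : dual) : Prop :=
  is_series (fun k => re (u k)) (re s) /\ is_series (fun k => du (u k)) (du s).

Lemma is_dual_series_unique (u : nat -> dual) (s t : dual) :
  is_dual_series u s -> is_dual_series u t -> s = t.
Proof.
  intros [H1 H2] [H3 H4]; apply dual_ext.
  - rewrite <- (is_series_unique _ _ H1); exact (is_series_unique _ _ H3).
  - rewrite <- (is_series_unique _ _ H2); exact (is_series_unique _ _ H4).
Qed.

Lemma is_dual_series_ext (u v : nat -> dual) (s : dual) :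
  (forall k, u k = v k) -> is_dual_series u s -> is_dual_series v s.
Proof.
  intros E [H1 H2]; split; [revert H1 | revert H2];
    apply is_series_ext; intros k; now rewrite E.
Qed.

Lemma is_dual_series_add (u v : nat -> dual) (s t : dual) :
  is_dual_series u s -> is_dual_series v t ->
  is_dual_series (fun k => u k + v k) (s + t).
Proof.
  intros [H1 H2] [H3 H4]; split.
  - exact (is_series_plus _ _ _ _ H1 H3).
  - exact (is_series_plus _ _ _ _ H2 H4).
Qed.

Lemma is_dual_series_mul_l (z : dual) (u : nat -> dual) (s : dual) :
  is_dual_series u s -> is_dual_series (fun k => z * u k) (z * s).
Proof.
  intros [H1 H2]; split.
  - exact (is_series_scal_l (re z) _ _ H1).
  - exact (is_series_plus _ _ _ _ (is_series_scal_l (re z) _ _ H2)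
                                  (is_series_scal_l (du z) _ _ H1)).
Qed.

Lemma is_dual_series_shift (u : nat -> dual) (s : dual) :
  u 0%nat = 0 -> is_dual_series (fun k => u (S k)) s -> is_dual_series u s.
Proof.
  intros E [H1 H2]; split; apply is_series_decr_1; rewrite E; simpl.
  - match goal with |- is_series _ ?l => replace l with (re s) end;
      [exact H1|unfold plus, opp; simpl; ring].
  - match goal with |- is_series _ ?l => replace l with (du s) end;
      [exact H2|unfold plus, opp; simpl; ring].
Qed.

(** * Entire dual power series *)

Definition dual_pseries (c : nat -> dual) (x : dual) : dual :=
  Dual (Series (fun k => re (c k * dual_pow x k)))
       (Series (fun k => du (c k * dual_pow x k))).

Definition dual_entire (c : nat -> dual) : Prop :=
  CV_radius (fun k => re (c k)) = p_infty /\
  CV_radius (fun k => du (c k)) = p_infty.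

Definition dual_PS_derive (c : nat -> dual) (k : nat) : dual :=
  dual_of_R (INR (S k)) * c (S k).

Lemma re_dual_PS_derive (c : nat -> dual) (k : nat) :
  re (dual_PS_derive c k) = PS_derive (fun j => re (c j)) k.
Proof. reflexivity. Qed.

Lemma du_dual_PS_derive (c : nat -> dual) (k : nat) :
  du (dual_PS_derive c k) = PS_derive (fun j => du (c j)) k.
Proof. unfold dual_PS_derive, PS_derive; cbn [du re dual_mul dual_of_R]; ring. Qed.

Lemma dual_entire_derive (c : nat -> dual) :
  dual_entire c -> dual_entire (dual_PS_derive c).
Proof.
  intros [H1 H2]; split.
  - rewrite <- H1, <- (CV_radius_derive (fun k => re (c k))).
    apply CV_radius_ext, re_dual_PS_derive.
  - rewrite <- H2, <- (CV_radius_derive (fun k => du (c k))).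
    apply CV_radius_ext, du_dual_PS_derive.
Qed.

Lemma is_series_infinite_radius (a : nat -> R) (t : R) :
  CV_radius a = p_infty -> is_series (fun k => a k * t ^ k)%R (PSeries a t).
Proof.
  intros H; apply is_pseries_R, PSeries_correct, CV_radius_inside.
  rewrite H; exact I.
Qed.

(** Since [x ^ k = x1 ^ k + eps k x1 ^ (k-1) x2], the dual part of the sum picks
    up [x2] times the derivative of the real part. *)
Lemma is_dual_series_parts (c : nat -> dual) (x : dual) :
  dual_entire c ->
  is_dual_series (fun k => c k * dual_pow x k)
    (Dual (PSeries (fun k => re (c k)) (re x))
          (PSeries (fun k => du (c k)) (re x)
           + du x * PSeries (PS_derive (fun k => re (c k))) (re x))).
Proof.
  intros [H1 H2]; split; cbn [re du].
  - eapply is_series_ext; [|exact (is_series_infinite_radius _ (re x) H1)].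
    intros k; rewrite dual_pow_parts; reflexivity.
  - rewrite <- (CV_radius_derive (fun k => re (c k))) in H1.
    apply is_series_ext with
      (fun k => plus (du (c k) * re x ^ k)%R
        (du x * (re (c k) * (INR k * re x ^ pred k)))%R).
    { intros k; rewrite dual_pow_parts; unfold plus; simpl; ring. }
    apply (is_series_plus (V := R_NormedModule));
      [exact (is_series_infinite_radius _ (re x) H2)|].
    apply (is_series_scal_l (K := R_AbsRing) (V := R_NormedModule) (du x)).
    apply is_series_decr_1.
    match goal with |- is_series _ ?l =>
      replace l with (PSeries (PS_derive (fun k => re (c k))) (re x))
        by (unfold plus, opp; simpl; ring) end.
    eapply is_series_ext; [|exact (is_series_infinite_radius _ (re x) H1)].
    intros k; unfold PS_derive; cbn [pred]; simpl; ring.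
Qed.

Lemma dual_pseries_parts (c : nat -> dual) (x : dual) :
  dual_entire c ->
  dual_pseries c x
  = Dual (PSeries (fun k => re (c k)) (re x))
         (PSeries (fun k => du (c k)) (re x)
          + du x * PSeries (PS_derive (fun k => re (c k))) (re x)).
Proof.
  intros H; destruct (is_dual_series_parts c x H) as [H1 H2].
  apply dual_ext; apply is_series_unique; assumption.
Qed.

Lemma is_dual_series_pseries (c : nat -> dual) (x : dual) :
  dual_entire c ->
  is_dual_series (fun k => c k * dual_pow x k) (dual_pseries c x).
Proof.
  intros H; rewrite dual_pseries_parts by exact H.
  now apply is_dual_series_parts.
Qed.

Lemma is_dual_derive_ext (F G : dual -> dual) (x l : dual) :
  (forall y, F y = G y) -> is_dual_derive F x l -> is_dual_derive G x l.
Proof.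
  intros E [H1 H2]; split; [revert H1 | revert H2];
    apply is_derive_ext; intros t; now rewrite E.
Qed.

Lemma is_dual_derive_pseries (c : nat -> dual) (x : dual) :
  dual_entire c ->
  is_dual_derive (dual_pseries c) x (dual_pseries (dual_PS_derive c) x).
Proof.
  intros H; pose proof H as [H1 H2].
  assert (D : forall (a : nat -> R) t, CV_radius a = p_infty ->
            is_derive (PSeries a) t (PSeries (PS_derive a) t)).
  { intros a t Ha; apply is_derive_PSeries; rewrite Ha; exact I. }
  rewrite (dual_pseries_parts (dual_PS_derive c))
    by now apply dual_entire_derive.
  split.
  - apply is_derive_ext with (PSeries (fun k => re (c k))).
    { intros t; now rewrite dual_pseries_parts. }
    apply D, H1.
  - apply is_derive_ext with
      (fun t => plus (PSeries (fun k => du (c k)) t)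
                  (du x * PSeries (PS_derive (fun k => re (c k))) t)%R).
    { intros t; now rewrite dual_pseries_parts. }
    cbn [du].
    rewrite (PSeries_ext _ _ (re x) (du_dual_PS_derive c)).
    apply (is_derive_plus (K := R_AbsRing) (V := R_NormedModule)); [apply D, H2|].
    apply is_derive_scal, (D (PS_derive (fun k => re (c k)))).
    now rewrite CV_radius_derive.
Qed.

(** Termwise effect of the Euler operator [x d/dx]: multiplying the derivative
    by [x] moves its coefficients back to their original exponents, and the
    constant term, which has factor [0], can be restored. *)
Lemma is_dual_series_euler (c : nat -> dual) (x : dual) :
  dual_entire c ->
  is_dual_series (fun k => dual_of_R (INR k) * c k * dual_pow x k)
    (x * dual_pseries (dual_PS_derive c) x).
Proof.
  intros H; apply is_dual_series_shift; [simpl; ring|].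
  apply is_dual_series_ext with
    (fun k => x * (dual_PS_derive c k * dual_pow x k)).
  { intros k; unfold dual_PS_derive; cbn [dual_pow]; ring. }
  now apply is_dual_series_mul_l, is_dual_series_pseries, dual_entire_derive.
Qed.

(** Comparison with the exponential series at [M * |r|] for every [r]. *)
Lemma CV_radius_le_exp (M : R) (a : nat -> R) :
  (forall k, Rabs (a k) <= M ^ k * / INR (fact k))%R -> CV_radius a = p_infty.
Proof.
  intros Ha.
  assert (HD : forall r, CV_disk a r).
  { intros r.
    apply (ex_series_le (K := R_AbsRing) (V := R_CompleteNormedModule))
      with (fun k => / INR (fact k) * (M * Rabs r) ^ k)%R.
    - intros k.
      change (Rabs (Rabs (a k * r ^ k))
              <= / INR (fact k) * (M * Rabs r) ^ k)%R.
      rewrite Rabs_Rabsolu, Rabs_mult, <- RPow_abs, Rpow_mult_distr.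
      pose proof (pow_le (Rabs r) k (Rabs_pos r)) as P.
      pose proof (Rmult_le_compat_r _ _ _ P (Ha k)); lra.
    - exists (exp (M * Rabs r)); apply is_pseries_R, is_exp_Reals. }
  unfold CV_radius; destruct (Lub_Rbar_correct (CV_disk a)) as [U _].
  destruct (Lub_Rbar (CV_disk a)) as [l| |]; [exfalso|reflexivity|exfalso].
  - pose proof (U _ (HD (l + 1)%R)) as L; simpl in L; lra.
  - exact (U _ (HD 0%R)).
Qed.

Lemma dual_entire_le_exp (M : R) (c : nat -> dual) :
  (forall k, dual_norm (c k) <= M ^ k * / INR (fact k))%R -> dual_entire c.
Proof.
  intros H; split; apply (CV_radius_le_exp M); intros k;
    specialize (H k); unfold dual_norm in H;
    pose proof (Rabs_pos (re (c k))); pose proof (Rabs_pos (du (c k))); lra.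
Qed.

(** * The confluent hypergeometric coefficients *)

Definition hyp1F1_coef (a b : dual) (k : nat) : dual :=
  dual_poch a k / (dual_poch b k * dual_of_R (INR (fact k))).

Lemma hyp1F1_pseries (a b x : dual) :
  hyp1F1 a b x = dual_pseries (hyp1F1_coef a b) x.
Proof.
  assert (E : forall k, hyp1F1_term a b x k = hyp1F1_coef a b k * dual_pow x k).
  { intros k; unfold hyp1F1_term, hyp1F1_coef, dual_div; ring. }
  apply dual_ext; apply Series_ext; intros k; now rewrite E.
Qed.

Lemma lower_parameter_shift (b : dual) (k : nat) :
  lower_parameter b -> (re b + INR k)%R <> 0%R.
Proof. intros Hb E; apply (Hb k); lra. Qed.

Lemma re_dual_poch_neq_0 (b : dual) (k : nat) :
  lower_parameter b -> re (dual_poch b k) <> 0%R.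
Proof.
  intros Hb; induction k as [|k IH]; [simpl; lra|].
  apply Rmult_integral_contrapositive_currified; [exact IH|].
  now apply lower_parameter_shift.
Qed.

Lemma re_hyp1F1_denominator_neq_0 (b : dual) (k : nat) :
  lower_parameter b ->
  re (dual_poch b k * dual_of_R (INR (fact k))) <> 0%R.
Proof.
  intros Hb; apply Rmult_integral_contrapositive_currified.
  - now apply re_dual_poch_neq_0.
  - apply INR_fact_neq_0.
Qed.

Lemma hyp1F1_coef_spec (a b : dual) (k : nat) :
  lower_parameter b ->
  dual_poch b k * dual_of_R (INR (fact k)) * hyp1F1_coef a b k = dual_poch a k.
Proof.
  intros Hb; unfold hyp1F1_coef, dual_div.
  pose proof (dual_mul_inv_r _ (re_hyp1F1_denominator_neq_0 b k Hb)) as E.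
  set (d := dual_poch b k * dual_of_R (INR (fact k))) in *.
  replace (d * (dual_poch a k * dual_inv d))
    with (dual_poch a k * (d * dual_inv d)) by ring.
  rewrite E; ring.
Qed.

Lemma dual_of_R_fact_S (k : nat) :
  dual_of_R (INR (fact (S k)))
  = dual_of_R (INR (S k)) * dual_of_R (INR (fact k)).
Proof. rewrite fact_simpl, mult_INR; apply dual_ext; simpl; ring. Qed.

Lemma hyp1F1_coef_S (a b : dual) (k : nat) :
  lower_parameter b ->
  hyp1F1_coef a b (S k)
  = hyp1F1_coef a b k
    * ((a + dual_of_R (INR k)) * dual_inv (b + dual_of_R (INR k)))
    * dual_inv (dual_of_R (INR (S k))).
Proof.
  intros Hb; unfold hyp1F1_coef, dual_div.
  rewrite dual_of_R_fact_S; cbn [dual_poch].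
  replace (dual_poch b k * (b + dual_of_R (INR k))
           * (dual_of_R (INR (S k)) * dual_of_R (INR (fact k))))
    with (dual_poch b k * dual_of_R (INR (fact k))
          * ((b + dual_of_R (INR k)) * dual_of_R (INR (S k)))) by ring.
  pose proof (lower_parameter_shift b k Hb) as Hk.
  pose proof (not_0_INR (S k) (Nat.neq_succ_0 k)) as HS.
  rewrite dual_inv_mul, (dual_inv_mul (b + dual_of_R (INR k))).
  - ring.
  - exact Hk.
  - exact HS.
  - now apply re_hyp1F1_denominator_neq_0.
  - now apply Rmult_integral_contrapositive_currified.
Qed.

(** Only finitely many of the numbers [b1 + k] have absolute value below 1, and
    none of them vanishes, so the smallest absolute value is a bound. *)
Lemma lower_parameter_dist (b : dual) :
  lower_parameter b ->
  exists d : R, (0 < d)%R /\ forall k : nat, (d <= Rabs (re b + INR k))%R.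
Proof.
  intros Hb.
  assert (F : forall N : nat, exists d : R, (0 < d)%R /\
            forall k, (k < N)%nat -> (d <= Rabs (re b + INR k))%R).
  { induction N as [|N [d [Hd IH]]].
    - exists 1%R; split; [lra|intros; lia].
    - exists (Rmin d (Rabs (re b + INR N))); split.
      + apply Rmin_glb_lt; [exact Hd|].
        now apply Rabs_pos_lt, lower_parameter_shift.
      + intros k Hk; destruct (Nat.eq_dec k N) as [->|Hne]; [apply Rmin_r|].
        eapply Rle_trans; [apply Rmin_l|apply IH; lia]. }
  destruct (INR_unbounded (1 - re b)) as [N HN].
  destruct (F N) as [d [Hd Hlt]].
  exists (Rmin d 1); split; [apply Rmin_glb_lt; lra|].
  intros k; destruct (Nat.lt_ge_cases k N) as [Hk|Hk].
  - eapply Rle_trans; [apply Rmin_l|now apply Hlt].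
  - eapply Rle_trans; [apply Rmin_r|].
    apply le_INR in Hk; rewrite Rabs_pos_eq; lra.
Qed.

(** The quotient is [1 + (a - b) / (b + k)], and [1 / (b + k)] is bounded because
    [b1 + k] stays away from zero. *)
Lemma dual_ratio_bounded (a b : dual) :
  lower_parameter b ->
  exists M : R, forall k : nat,
    (dual_norm ((a + dual_of_R (INR k)) * dual_inv (b + dual_of_R (INR k)))
     <= M)%R.
Proof.
  intros Hb; destruct (lower_parameter_dist b Hb) as [d [Hd Hdist]].
  exists (1 + dual_norm (a - b) * (/ d + Rabs (du b) * (/ d) ^ 2))%R.
  intros k; set (y := b + dual_of_R (INR k)).
  assert (Hy : re y <> 0%R) by exact (lower_parameter_shift b k Hb).
  replace ((a + dual_of_R (INR k)) * dual_inv y)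
    with (y * dual_inv y + (a - b) * dual_inv y) by (unfold y; ring).
  rewrite dual_mul_inv_r by exact Hy.
  eapply Rle_trans; [apply dual_norm_add|].
  apply Rplus_le_compat.
  { unfold dual_norm; simpl; rewrite Rabs_R1, Rabs_R0; lra. }
  eapply Rle_trans; [apply dual_norm_mul|].
  apply Rmult_le_compat_l; [apply dual_norm_ge_0|].
  assert (Hi : (Rabs (/ re y) <= / d)%R).
  { rewrite Rabs_inv; apply Rinv_le_contravar; [exact Hd|exact (Hdist k)]. }
  unfold dual_norm; cbn [re du dual_inv].
  replace (du y) with (du b) by (unfold y; simpl; ring).
  rewrite Rabs_Ropp; unfold Rdiv.
  rewrite Rabs_mult, <- pow_inv, <- RPow_abs.
  apply Rplus_le_compat; [exact Hi|].
  apply Rmult_le_compat_l; [apply Rabs_pos|].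
  apply pow_incr; split; [apply Rabs_pos|exact Hi].
Qed.

Lemma entire_hyp1F1_coef (a b : dual) :
  lower_parameter b -> dual_entire (hyp1F1_coef a b).
Proof.
  intros Hb; destruct (dual_ratio_bounded a b Hb) as [M HM].
  apply (dual_entire_le_exp M).
  induction k as [|k IH].
  - replace (hyp1F1_coef a b 0) with 1.
    + unfold dual_norm; simpl; rewrite Rabs_R1, Rabs_R0; lra.
    + apply dual_ext; simpl; field.
  - rewrite hyp1F1_coef_S by exact Hb.
    eapply Rle_trans; [apply dual_norm_mul|].
    assert (HS : dual_norm (dual_inv (dual_of_R (INR (S k)))) = (/ INR (S k))%R).
    { pose proof (lt_0_INR _ (Nat.lt_0_succ k)).
      unfold dual_norm; cbn [re du dual_inv dual_of_R].
      unfold Rdiv; rewrite Rmult_0_l, Ropp_0, Rabs_R0, Rplus_0_r.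
      apply Rabs_pos_eq; left; now apply Rinv_0_lt_compat. }
    rewrite HS, fact_simpl, mult_INR, Rinv_mult.
    replace (M ^ S k * (/ INR (S k) * / INR (fact k)))%R
      with (M ^ k * / INR (fact k) * M * / INR (S k))%R by (simpl pow; ring).
    apply Rmult_le_compat_r.
    { left; apply Rinv_0_lt_compat, lt_0_INR, Nat.lt_0_succ. }
    eapply Rle_trans; [apply dual_norm_mul|].
    apply Rmult_le_compat; auto using dual_norm_ge_0.
Qed.

(** * Contiguity relations *)

(** Two ways of splitting a product of [k + 1] consecutive factors: the last
    factor taken apart on the left, the first one on the right. *)
Lemma dual_poch_shift (a : dual) (k : nat) :
  dual_poch (a - 1) k * (a - 1 + dual_of_R (INR k)) = (a - 1) * dual_poch a k.
Proof.
  induction k as [|k IH].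
  - apply dual_ext; simpl; ring.
  - cbn [dual_poch]; rewrite IH, dual_of_R_S; ring.
Qed.

Lemma hyp1F1_coef_upper (a b : dual) (k : nat) :
  (a - 1 + dual_of_R (INR k)) * hyp1F1_coef (a - 1) b k
  = (a - 1) * hyp1F1_coef a b k.
Proof.
  unfold hyp1F1_coef, dual_div.
  set (i := dual_inv _).
  replace ((a - 1) * (dual_poch a k * i)) with ((a - 1) * dual_poch a k * i)
    by ring.
  rewrite <- dual_poch_shift; ring.
Qed.

Lemma hyp1F1_coef_lower (a b : dual) (k : nat) :
  lower_parameter b -> lower_parameter (b - 1) ->
  (b - 1 + dual_of_R (INR k)) * hyp1F1_coef a b k
  = (b - 1) * hyp1F1_coef a (b - 1) k.
Proof.
  intros Hb Hb1.
  apply (dual_mul_cancel_l _ _ _ (re_hyp1F1_denominator_neq_0 (b - 1) k Hb1)).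
  transitivity ((b - 1) * dual_poch a k).
  - rewrite <- (hyp1F1_coef_spec a b k Hb).
    replace ((b - 1)
             * (dual_poch b k * dual_of_R (INR (fact k)) * hyp1F1_coef a b k))
      with ((b - 1) * dual_poch b k
            * dual_of_R (INR (fact k)) * hyp1F1_coef a b k) by ring.
    rewrite <- dual_poch_shift; ring.
  - rewrite <- (hyp1F1_coef_spec a (b - 1) k Hb1); ring.
Qed.

Lemma hyp1F1_coef_recurrence (a b : dual) (k : nat) :
  lower_parameter b ->
  (b + dual_of_R (INR k)) * dual_PS_derive (hyp1F1_coef a b) k
  = (a + dual_of_R (INR k)) * hyp1F1_coef a b k.
Proof.
  intros Hb.
  apply (dual_mul_cancel_l _ _ _ (re_hyp1F1_denominator_neq_0 b k Hb)).
  transitivity (dual_poch a (S k)).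
  - rewrite <- (hyp1F1_coef_spec a b (S k) Hb), dual_of_R_fact_S.
    unfold dual_PS_derive; cbn [dual_poch]; ring.
  - cbn [dual_poch]; rewrite <- (hyp1F1_coef_spec a b k Hb); ring.
Qed.

Lemma hyp1F1_coef_derive (a b : dual) (k : nat) :
  lower_parameter b -> lower_parameter (b - 1) ->
  (b - 1) * dual_PS_derive (hyp1F1_coef (a - 1) (b - 1)) k
  = (a - 1) * hyp1F1_coef a b k.
Proof.
  intros Hb Hb1.
  apply (dual_mul_cancel_l (b - 1 + dual_of_R (INR k)));
    [exact (lower_parameter_shift (b - 1) k Hb1)|].
  transitivity
    ((b - 1) * ((b - 1 + dual_of_R (INR k))
                * dual_PS_derive (hyp1F1_coef (a - 1) (b - 1)) k)); [ring|].
  rewrite hyp1F1_coef_recurrence, hyp1F1_coef_upper by exact Hb1.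
  transitivity
    ((a - 1) * ((b - 1 + dual_of_R (INR k)) * hyp1F1_coef a b k)); [|ring].
  rewrite hyp1F1_coef_lower by assumption; ring.
Qed.

(** After multiplication by [b - 1 + k] the derivative contributes the factor
    [a + k] by the recurrence, and [a + k] splits as
    [(b - 1 + k) + (1 + a - b)]; the second summand is where the parameter [b]
    reappears. *)
Lemma hyp1F1_coef_derive_sub (a b : dual) (k : nat) :
  lower_parameter b -> lower_parameter (b - 1) ->
  (b - 1) * dual_PS_derive (hyp1F1_coef a (b - 1)) k
  = (b - 1) * hyp1F1_coef a (b - 1) k + (1 + a - b) * hyp1F1_coef a b k.
Proof.
  intros Hb Hb1.
  apply (dual_mul_cancel_l (b - 1 + dual_of_R (INR k)));
    [exact (lower_parameter_shift (b - 1) k Hb1)|].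
  transitivity
    ((b - 1) * ((b - 1 + dual_of_R (INR k))
                * dual_PS_derive (hyp1F1_coef a (b - 1)) k)); [ring|].
  rewrite hyp1F1_coef_recurrence by exact Hb1.
  transitivity
    ((b - 1 + dual_of_R (INR k)) * ((b - 1) * hyp1F1_coef a (b - 1) k)
     + (1 + a - b) * ((b - 1 + dual_of_R (INR k)) * hyp1F1_coef a b k)); [|ring].
  rewrite hyp1F1_coef_lower by assumption; ring.
Qed.

Definition hyp1F1_derive (a b x : dual) : dual :=
  dual_pseries (dual_PS_derive (hyp1F1_coef a b)) x.

Lemma is_dual_series_hyp1F1 (a b x : dual) :
  lower_parameter b ->
  is_dual_series (fun k => hyp1F1_coef a b k * dual_pow x k) (hyp1F1 a b x).
Proof.
  intros Hb; rewrite hyp1F1_pseries.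
  now apply is_dual_series_pseries, entire_hyp1F1_coef.
Qed.

Lemma is_dual_series_hyp1F1_derive (a b x : dual) :
  lower_parameter b ->
  is_dual_series (fun k => dual_PS_derive (hyp1F1_coef a b) k * dual_pow x k)
    (hyp1F1_derive a b x).
Proof.
  intros Hb.
  now apply is_dual_series_pseries, dual_entire_derive, entire_hyp1F1_coef.
Qed.

Lemma is_dual_derive_hyp1F1 (a b x : dual) :
  lower_parameter b ->
  is_dual_derive (hyp1F1 a b) x (hyp1F1_derive a b x).
Proof.
  intros Hb.
  apply is_dual_derive_ext with (dual_pseries (hyp1F1_coef a b)).
  { intros y; now rewrite hyp1F1_pseries. }
  now apply is_dual_derive_pseries, entire_hyp1F1_coef.
Qed.

Lemma hyp1F1_derive_contiguous (a b x : dual) :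
  lower_parameter b -> lower_parameter (b - 1) ->
  (b - 1) * hyp1F1_derive (a - 1) (b - 1) x = (a - 1) * hyp1F1 a b x.
Proof.
  intros Hb Hb1.
  apply is_dual_series_unique with
    (fun k => (a - 1) * (hyp1F1_coef a b k * dual_pow x k)).
  - eapply is_dual_series_ext;
      [|exact (is_dual_series_mul_l (b - 1) _ _
                 (is_dual_series_hyp1F1_derive (a - 1) (b - 1) x Hb1))].
    intros k; cbv beta.
    transitivity ((b - 1) * dual_PS_derive (hyp1F1_coef (a - 1) (b - 1)) k
                  * dual_pow x k); [ring|].
    rewrite hyp1F1_coef_derive by assumption; ring.
  - now apply is_dual_series_mul_l, is_dual_series_hyp1F1.
Qed.

(** The operator [c + x d/dx] is diagonal on powers of [x], with eigenvalue
    [c + k] on [x ^ k].  Raising a lower parameter or lowering an upper one only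
    changes the coefficients by such a factor, up to the constant [c]. *)
Lemma dual_pseries_euler (c x : dual) (u v : nat -> dual) :
  dual_entire u -> dual_entire v ->
  (forall k, (c + dual_of_R (INR k)) * u k = c * v k) ->
  c * dual_pseries u x + x * dual_pseries (dual_PS_derive u) x
  = c * dual_pseries v x.
Proof.
  intros Hu Hv E.
  apply is_dual_series_unique with (fun k => c * (v k * dual_pow x k)).
  - eapply is_dual_series_ext;
      [|exact (is_dual_series_add _ _ _ _
                 (is_dual_series_mul_l c _ _ (is_dual_series_pseries u x Hu))
                 (is_dual_series_euler u x Hu))].
    intros k; cbv beta.
    transitivity ((c + dual_of_R (INR k)) * u k * dual_pow x k); [ring|].
    rewrite E; ring.
  - now apply is_dual_series_mul_l, is_dual_series_pseries.
Qed.

Lemma hyp1F1_euler_lower (a b x : dual) :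
  lower_parameter b -> lower_parameter (b + 1) ->
  b * hyp1F1 a (b + 1) x + x * hyp1F1_derive a (b + 1) x = b * hyp1F1 a b x.
Proof.
  intros Hb Hb1; rewrite !hyp1F1_pseries.
  apply dual_pseries_euler; try now apply entire_hyp1F1_coef.
  intros k.
  assert (E : b + 1 - 1 = b) by ring.
  pose proof (hyp1F1_coef_lower a (b + 1) k Hb1) as L.
  rewrite E in L; exact (L Hb).
Qed.

Lemma hyp1F1_euler_upper (a b x : dual) :
  lower_parameter b ->
  (a - 1) * hyp1F1 (a - 1) b x + x * hyp1F1_derive (a - 1) b x
  = (a - 1) * hyp1F1 a b x.
Proof.
  intros Hb; rewrite !hyp1F1_pseries.
  apply dual_pseries_euler; try now apply entire_hyp1F1_coef.
  intros k; apply hyp1F1_coef_upper.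
Qed.

Lemma hyp1F1_derive_sub_contiguous (a b x : dual) :
  lower_parameter b -> lower_parameter (b - 1) ->
  (b - 1) * hyp1F1_derive a (b - 1) x
  = (b - 1) * hyp1F1 a (b - 1) x + (1 + a - b) * hyp1F1 a b x.
Proof.
  intros Hb Hb1.
  eapply is_dual_series_unique.
  - exact (is_dual_series_mul_l (b - 1) _ _
             (is_dual_series_hyp1F1_derive a (b - 1) x Hb1)).
  - eapply is_dual_series_ext;
      [|exact (is_dual_series_add _ _ _ _
          (is_dual_series_mul_l (b - 1) _ _
             (is_dual_series_hyp1F1 a (b - 1) x Hb1))
          (is_dual_series_mul_l (1 + a - b) _ _
             (is_dual_series_hyp1F1 a b x Hb)))].
    intros k; cbv beta.
    transitivity ((b - 1) * dual_PS_derive (hyp1F1_coef a (b - 1)) k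
                  * dual_pow x k); [|ring].
    rewrite hyp1F1_coef_derive_sub by assumption; ring.
Qed.

(** * Dual derivatives of products, powers and exponentials *)

Lemma Dual_re_du (x : dual) : Dual (re x) (du x) = x.
Proof. now destruct x. Qed.

Lemma is_dual_derive_mul (F G : dual -> dual) (x f g : dual) :
  is_dual_derive F x f -> is_dual_derive G x g ->
  is_dual_derive (fun y => F y * G y) x (f * G x + F x * g).
Proof.
  intros [F1 F2] [G1 G2].
  assert (M : forall (p q : R -> R) t dp dq,
            is_derive p t dp -> is_derive q t dq ->
            is_derive (fun s => p s * q s)%R t (dp * q t + p t * dq)%R).
  { intros p q t dp dq Hp Hq.
    exact (is_derive_mult p q t dp dq Hp Hq Rmult_comm). }
  split.
  - pose proof (M _ _ _ _ _ F1 G1) as H; cbv beta in H; rewrite Dual_re_du in H; exact H.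
  - pose proof (is_derive_plus _ _ _ _ _ (M _ _ _ _ _ F1 G2)
                                         (M _ _ _ _ _ F2 G1)) as H.
    cbv beta in H; rewrite Dual_re_du in H.
    match type of H with is_derive _ _ ?l =>
      replace (du (f * G x + F x * g)) with l;
        [exact H|unfold plus; simpl; ring]
    end.
Qed.

Lemma is_dual_derive_mul_l (z : dual) (G : dual -> dual) (x g : dual) :
  is_dual_derive G x g -> is_dual_derive (fun y => z * G y) x (z * g).
Proof.
  intros H.
  replace (z * g) with (0 * G x + z * g) by ring.
  apply (is_dual_derive_mul (fun _ => z)); [|exact H].
  split; apply (is_derive_const (K := R_AbsRing) (V := R_NormedModule)).
Qed.

Lemma is_dual_derive_exp_opp (x : dual) :
  is_dual_derive (fun y => dual_exp (- y)) x (- dual_exp (- x)).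
Proof.
  split; cbn [re du dual_exp dual_opp]; auto_derive; trivial; ring.
Qed.

Lemma Rpower_sub_1 (t c : R) :
  (0 < t)%R -> Rpower t (c + - (1)) = (Rpower t c / t)%R.
Proof.
  intros Ht; rewrite Rpower_plus, Rpower_Ropp, Rpower_1 by exact Ht.
  reflexivity.
Qed.

Lemma dual_power_sub_1 (x c : dual) :
  (0 < re x)%R -> dual_power x (c - 1) * x = dual_power x c.
Proof.
  intros Hx.
  pose proof (Rpower_sub_1 (re x) (re c) Hx) as E.
  apply dual_ext; simpl; rewrite E; field; lra.
Qed.

Lemma is_dual_derive_power (c x : dual) :
  (0 < re x)%R ->
  is_dual_derive (fun y => dual_power y c) x (c * dual_power x (c - 1)).
Proof.
  intros Hx.
  pose proof (Rpower_sub_1 (re x) (re c) Hx) as E.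
  split; simpl; rewrite E; unfold Rpower; auto_derive.
  - exact Hx.
  - field; lra.
  - repeat split; trivial; lra.
  - field; lra.
Qed.

(** The Euler relation [c P + x P' = c F] is exactly what makes the derivative
    of [x ^ c P] equal to [c x ^ (c - 1) F]. *)
Lemma is_dual_derive_power_euler (c x f p : dual) (P : dual -> dual) :
  (0 < re x)%R -> re c <> 0%R ->
  is_dual_derive P x p -> c * P x + x * p = c * f ->
  is_dual_derive (fun y => dual_power y c / c * P y) x
    (dual_power x (c - 1) * f).
Proof.
  intros Hx Hc HP E.
  apply is_dual_derive_ext with (fun y => dual_inv c * (dual_power y c * P y)).
  { intros y; unfold dual_div; ring. }
  replace (dual_power x (c - 1) * f)
    with (dual_inv c
          * (c * dual_power x (c - 1) * P x + dual_power x c * p)).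
  { apply is_dual_derive_mul_l.
    apply (is_dual_derive_mul (fun y => dual_power y c) P); [|exact HP].
    now apply is_dual_derive_power. }
  rewrite <- (dual_power_sub_1 x c Hx).
  transitivity (dual_inv c * (dual_power x (c - 1) * (c * P x + x * p)));
    [ring|].
  rewrite E.
  transitivity (c * dual_inv c * (dual_power x (c - 1) * f)); [ring|].
  rewrite dual_mul_inv_r by exact Hc; ring.
Qed.

(** * The integral formulas *)

Theorem theorem7p1 :
  forall a b : dual,
  (lower_parameter b -> lower_parameter (b - 1) -> re (a - 1) <> 0%R ->
     is_dual_integral all_reals
       (fun x => hyp1F1 a b x)
       (fun x => (b - 1) / (a - 1) * hyp1F1 (a - 1) (b - 1) x))
  /\
  (lower_parameter b -> lower_parameter (b + 1) -> re b <> 0%R ->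
     is_dual_integral positive_reals
       (fun x => dual_power x (b - 1) * hyp1F1 a b x)
       (fun x => dual_power x b / b * hyp1F1 a (b + 1) x))
  /\
  (lower_parameter b -> re (a - 1) <> 0%R ->
     is_dual_integral positive_reals
       (fun x => dual_power x (a - 2) * hyp1F1 a b x)
       (fun x => dual_power x (a - 1) / (a - 1) * hyp1F1 (a - 1) b x))
  /\
  (lower_parameter b -> lower_parameter (b - 1) -> re (1 + a - b) <> 0%R ->
     is_dual_integral all_reals
       (fun x => dual_exp (- x) * hyp1F1 a b x)
       (fun x => dual_exp (- x) * (b - 1) / (1 + a - b)
                 * hyp1F1 a (b - 1) x)).
Proof.
  intros a b; split; [|split; [|split]].
  - intros Hb Hb1 Ha x _.
    replace (hyp1F1 a b x)
      with ((b - 1) / (a - 1) * hyp1F1_derive (a - 1) (b - 1) x).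
    { now apply is_dual_derive_mul_l, is_dual_derive_hyp1F1. }
    unfold dual_div.
    transitivity (dual_inv (a - 1)
                  * ((b - 1) * hyp1F1_derive (a - 1) (b - 1) x)); [ring|].
    rewrite hyp1F1_derive_contiguous by assumption.
    transitivity ((a - 1) * dual_inv (a - 1) * hyp1F1 a b x); [ring|].
    rewrite dual_mul_inv_r by exact Ha; ring.
  - intros Hb Hb1 Hb0 x Hx.
    apply (is_dual_derive_power_euler b x _ (hyp1F1_derive a (b + 1) x));
      [exact Hx|exact Hb0|now apply is_dual_derive_hyp1F1|].
    now apply hyp1F1_euler_lower.
  - intros Hb Ha x Hx.
    replace (a - 2) with (a - 1 - 1) by (apply dual_ext; simpl; ring).
    apply (is_dual_derive_power_euler (a - 1) x _ (hyp1F1_derive (a - 1) b x));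
      [exact Hx|exact Ha|now apply is_dual_derive_hyp1F1|].
    now apply hyp1F1_euler_upper.
  - intros Hb Hb1 Hab x _.
    set (d := 1 + a - b) in *.
    apply is_dual_derive_ext with
      (fun y => (b - 1) / d * (dual_exp (- y) * hyp1F1 a (b - 1) y)).
    { intros y; unfold dual_div; ring. }
    replace (dual_exp (- x) * hyp1F1 a b x)
      with ((b - 1) / d
            * (- dual_exp (- x) * hyp1F1 a (b - 1) x
               + dual_exp (- x) * hyp1F1_derive a (b - 1) x)).
    { apply is_dual_derive_mul_l.
      apply (is_dual_derive_mul (fun y => dual_exp (- y)) (hyp1F1 a (b - 1)));
        [apply is_dual_derive_exp_opp|now apply is_dual_derive_hyp1F1]. }
    unfold dual_div.
    transitivity (dual_inv d * dual_exp (- x)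
                  * ((b - 1) * hyp1F1_derive a (b - 1) x
                     - (b - 1) * hyp1F1 a (b - 1) x)); [ring|].
    rewrite hyp1F1_derive_sub_contiguous by assumption; fold d.
    transitivity (d * dual_inv d * (dual_exp (- x) * hyp1F1 a b x)); [ring|].
    rewrite dual_mul_inv_r by exact Hab; ring.
Qed.
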